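(* For every integer $1\le n\le 4$ and every $1\le p<\infty$, the seminorm $\sigma_p$ is strongly Leibniz on the real $\ell_n^\infty$ endowed with the uniform distribution.
   Context: The real $\ell_n^\infty$ is $\mathbb{R}^n$ with coordinatewise multiplication and norm $\|f\|_\infty=\max_i|f_i|$. With the uniform distribution on $\{1,\dots,n\}$ (each point has mass $1/n$), $\mathbb{E}f=\frac1n\sum_{i=1}^nf_i$ and $\sigma_p(f)=\left(\frac1n\sum_{i=1}^n|f_i-\mathbb{E}f|^p\right)^{1/p}$. A seminorm $L$ on a unital normed algebra $(\mathcal{A},\|\cdot\|)$ is called strongly Leibniz if (i) $L(1_\mathcal{A})=0$; (ii) $L(ab)\le\|a\|L(b)+\|b\|L(a)$ for all $a,b\in\mathcal{A}$; and (iii) $L(a^{-1})\le\|a^{-1}\|^2L(a)$ for every invertible $a\in\mathcal{A}$. *)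

(* Defs.v *)
From HB Require Import structures.
From mathcomp Require Import all_boot all_order all_algebra.
From mathcomp Require Import reals exp.

Set Implicit Arguments.
Unset Strict Implicit.
Unset Printing Implicit Defensive.
Import Order.TTheory GRing.Theory Num.Theory.
Local Open Scope ring_scope.

(* The norm is a field of this interface, rather than the library's [`|_|],
   because the hierarchy has no join of rings and normed Z-modules below
   [numDomainType]. *)
HB.mixin Record isUnitalNormedAlgebra (R : realType) A
    of GRing.UnitAlgebra R A := {
  algnorm : A -> R;
  algnormD : forall a b : A, algnorm (a + b) <= algnorm a + algnorm b;
  algnormZ : forall (k : R) (a : A), algnorm (k *: a) = `|k| * algnorm a;
  algnorm0_eq0 : forall a : A, algnorm a = 0 -> a = 0;
  algnormM : forall a b : A, algnorm (a * b) <= algnorm a * algnorm b;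
  algnorm1 : algnorm 1 = 1
}.

#[short(type="unitalNormedAlgType")]
HB.structure Definition UnitalNormedAlgebra (R : realType) :=
  { A of GRing.UnitAlgebra R A & isUnitalNormedAlgebra R A }.

Record is_seminorm (R : realType) (V : lmodType R) (L : V -> R) : Prop :=
  IsSeminorm {
    seminorm_ge0 : forall v, 0 <= L v;
    seminormZ : forall (k : R) v, L (k *: v) = `|k| * L v;
    seminormD : forall v w, L (v + w) <= L v + L w
  }.

Record strongly_leibniz (R : realType) (A : unitalNormedAlgType R)
    (L : A -> R) : Prop := StronglyLeibniz {
  strongly_leibniz_seminorm : is_seminorm L;
  strongly_leibniz1 : L 1 = 0;
  strongly_leibnizM : forall a b : A,
    L (a * b) <= algnorm a * L b + algnorm b * L a;
  strongly_leibnizV : forall a : A, a \is a GRing.unit ->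
    L a^-1 <= algnorm a^-1 ^+ 2 * L a
}.

Definition linf (R : realType) (n : nat) : Type := {ffun 'I_n -> R}.

HB.instance Definition _ (R : realType) (n : nat) :=
  GRing.PzRing.copy (linf R n) {ffun 'I_n -> R}.
HB.instance Definition _ (R : realType) (n : nat) :=
  GRing.Lmodule.copy (linf R n) {ffun 'I_n -> R^o}.

Section LinfNorm.
Variables (R : realType) (n : nat).
Implicit Types f g : linf R n.

(* All terms are nonnegative, so for n > 0 the neutral element 0 does not
   affect the maximum. *)
Definition linf_norm f : R := \big[Num.max/0]_(i < n) `|f i|.

Lemma linf_addE f g i : (f + g) i = f i + g i.
Proof. by rewrite ffunE. Qed.

Lemma linf_mulE f g i : (f * g) i = f i * g i.
Proof. by rewrite ffunE. Qed.

Lemma linf_scaleE (k : R) f i : (k *: f) i = k * f i.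
Proof. by rewrite ffunE. Qed.

Lemma linf_norm_ge0 f : 0 <= linf_norm f.
Proof. exact: bigmax_ge_id. Qed.

Lemma linf_norm_ge f i : `|f i| <= linf_norm f.
Proof. exact: (le_bigmax _ (fun i => `|f i|)). Qed.

Lemma linf_norm_le f (c : R) :
  0 <= c -> (forall i, `|f i| <= c) -> linf_norm f <= c.
Proof. by move=> c0 fc; apply: bigmax_le. Qed.

Fact linf_normD f g : linf_norm (f + g) <= linf_norm f + linf_norm g.
Proof.
apply: linf_norm_le => [|i]; first by rewrite addr_ge0// linf_norm_ge0.
by rewrite linf_addE (le_trans (ler_normD _ _))// lerD// linf_norm_ge.
Qed.

Fact linf_norm0_eq0 f : linf_norm f = 0 -> f = 0.
Proof.
move=> f0; apply/ffunP => i; rewrite ffunE; apply/normr0_eq0/eqP.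
by rewrite eq_le normr_ge0 andbT -f0 linf_norm_ge.
Qed.

Fact linf_normZ (k : R) f : linf_norm (k *: f) = `|k| * linf_norm f.
Proof.
have le c g : linf_norm (c *: g) <= `|c| * linf_norm g.
  apply: linf_norm_le => [|i]; first by rewrite mulr_ge0// linf_norm_ge0.
  by rewrite linf_scaleE normrM ler_wpM2l// linf_norm_ge.
apply/eqP; rewrite eq_le le /=.
have [->|k0] := eqVneq k 0; first by rewrite normr0 mul0r linf_norm_ge0.
rewrite -ler_pdivlMl ?normr_gt0// -normfV.
by have := le k^-1 (k *: f); rewrite scalerA mulVf// scale1r.
Qed.

Fact linf_normM f g : linf_norm (f * g) <= linf_norm f * linf_norm g.
Proof.
apply: linf_norm_le => [|i]; first by rewrite mulr_ge0// linf_norm_ge0.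
by rewrite linf_mulE normrM ler_pM// linf_norm_ge.
Qed.

Definition mean f : R := n%:R^-1 * \sum_(i < n) f i.

Definition sigma (p : R) f : R :=
  (n%:R^-1 * \sum_(i < n) `|f i - mean f| `^ p) `^ p^-1.

End LinfNorm.

(* As an algebra with 1 != 0, [linf R n] is only defined for n > 0. *)
Section LinfAlgebra.
Variables (R : realType) (n : nat).
Local Notation A := (linf R n.+1).
Implicit Types f g : A.

Fact linf_oner_neq0 : 1 != 0 :> A.
Proof. by apply/eqP => /ffunP/(_ ord0)/eqP; rewrite !ffunE oner_eq0. Qed.

HB.instance Definition _ := GRing.PzSemiRing_isNonZero.Build A linf_oner_neq0.

Fact linf_scalerAl (k : R) f g : k *: (f * g) = (k *: f) * g.
Proof.
by apply/ffunP => i; rewrite linf_scaleE !linf_mulE linf_scaleE mulrA.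
Qed.

HB.instance Definition _ := GRing.Lmodule_isLalgebra.Build R A linf_scalerAl.

Fact linf_scalerAr (k : R) f g : k *: (f * g) = f * (k *: g).
Proof.
by apply/ffunP => i; rewrite linf_scaleE !linf_mulE linf_scaleE mulrCA.
Qed.

HB.instance Definition _ := GRing.Lalgebra_isAlgebra.Build R A linf_scalerAr.

Definition linf_unit : pred A := fun f => [forall i, f i != 0].

(* Totalized as the library requires: noninvertible elements are fixed. *)
Definition linf_inv f : A := if linf_unit f then [ffun i => (f i)^-1] else f.

Fact linf_mulVr : {in linf_unit, left_inverse 1 linf_inv *%R}.
Proof.
move=> f uf; apply/ffunP => i; rewrite linf_mulE /linf_inv.
by rewrite -topredE /= in uf; rewrite uf !ffunE mulVf// (forallP uf).
Qed.

Fact linf_mulrV : {in linf_unit, right_inverse 1 linf_inv *%R}.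
Proof.
move=> f uf; rewrite -[RHS](linf_mulVr uf).
by apply/ffunP => i; rewrite !linf_mulE mulrC.
Qed.

Fact linf_unitP f g : g * f = 1 /\ f * g = 1 -> linf_unit f.
Proof.
case=> /ffunP gf _; apply/forallP => i; apply: contraTneq (oner_neq0 R) => fi0.
by have := gf i; rewrite linf_mulE fi0 mulr0 ffunE => <-; rewrite eqxx.
Qed.

Fact linf_inv_out : {in [predC linf_unit], linf_inv =1 id}.
Proof. by move=> f; rewrite inE /= /linf_inv -topredE /= => /negbTE ->. Qed.

HB.instance Definition _ := GRing.NzRing_hasMulInverse.Build A
  linf_mulVr linf_mulrV linf_unitP linf_inv_out.

Fact linf_norm1 : linf_norm (1 : A) = 1.
Proof.
apply/eqP; rewrite eq_le linf_norm_le//=.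
  by have := linf_norm_ge (1 : A) ord0; rewrite ffunE normr1.
by move=> i; rewrite ffunE normr1.
Qed.

HB.instance Definition _ := isUnitalNormedAlgebra.Build R A
  (@linf_normD R n.+1) (@linf_normZ R n.+1) (@linf_norm0_eq0 R n.+1)
  (@linf_normM R n.+1) linf_norm1.

End LinfAlgebra.

(* Main.v *)
Require Import Defs.
From HB Require Import structures.
From mathcomp Require Import all_boot all_order all_algebra fingroup perm.
From mathcomp Require Import reals exp.
From mathcomp Require Import zify lra ring.

(** The product and inverse rules have a common source: both
    [|f i * g i - f j * g j|] and [|(f i)^-1 - (f j)^-1|] are bounded by
    combinations of the differences [|f i - f j|] and [|g i - g j|] with the
    right norms as coefficients.  So it suffices to know ([sigma_le]) that

      [|h i - h j| <= C * |u i - u j| + D * |v i - v j|]  for all [i], [j]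

    implies [sigma p h <= C * sigma p u + D * sigma p v].  The triangle
    inequality and the homogeneity of [sigma p] are also instances.

    Write [h'], [u'], [v'] for the deviations from the mean.  Every [p]-norm is
    monotone under weak majorization, so the implication reduces to the Ky Fan
    norms, that is, to the sums of the [k] largest absolute values
    ([lnorm_weak_majorization]).  Such a sum is [\sum_i e i * h' i] for some
    [e] with entries in {1, 0, -1}, of which [k] are nonzero.  Since [h'] has
    sum zero, the covariance identity gives

      [\sum_i e i * h' i = (2n)^-1 * \sum_i \sum_j (e i - e j) * (h i - h j)],

    where only differences of [h] occur, and the hypothesis bounds it by
    [(2n)^-1 * (C * spread e u + D * spread e v)], where [spread e u] is
    [\sum_i \sum_j |e i - e j| * |u i - u j|].

    What remains is that [(2n)^-1 * spread e u] is at most the [k]-th Ky Fan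
    norm of [u'], and this is where [n <= 4] enters.  If [e] is monotone or
    antitone along [u], the absolute values disappear, [(2n)^-1 * spread e u]
    is [|\sum_i e i * u' i|], and the bound is clear.  For [n <= 4] one of these
    two arrangements of the entries of [e] maximizes the spread
    ([sorted_spread_le_contrast], a finite verification). *)

Set Implicit Arguments.
Unset Strict Implicit.
Unset Printing Implicit Defensive.
Import Order.TTheory GRing.Theory Num.Theory.
Local Open Scope ring_scope.

(** * Sorted vectors *)

Lemma exists_sorting_perm (R : realType) n (x : 'I_n -> R) :
  exists s : 'S_n, forall i j : 'I_n, (i <= j)%N -> x (s j) <= x (s i).
Proof.
pose t := [tuple x i | i < n].
have /tuple_permP[s ts] : perm_eq (sort >=%R t) t by rewrite perm_sort.
exists s => i j ij.
have xsE k : x (s k) = nth 0 (sort >=%R t) k.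
  by rewrite ts (nth_map k) ?size_enum_ord// nth_ord_enum tnth_mktuple.
rewrite !xsE.
have /(_ i j) := sorted_leq_nth (rev_trans le_trans) ge_refl 0
  (sort_sorted (fun a b => le_total b a) t).
by rewrite !inE size_sort size_tuple !ltn_ord => /(_ isT isT ij).
Qed.

(** Summation by parts: [w] is a nonnegative combination of the indicators of
    initial segments, on each of which [d] has a nonnegative sum. *)
Lemma abel_sum_ge0 (R : realType) n (w d : 'I_n -> R) :
  (forall i, 0 <= w i) -> (forall i j : 'I_n, (i <= j)%N -> w j <= w i) ->
  (forall k, (k <= n)%N -> 0 <= \sum_(i < n | (i < k)%N) d i) ->
  0 <= \sum_i w i * d i.
Proof.
move=> w0 wdec dge0.
(* The induction needs this for every lower bound c of w: the step applies it to
   all weights but the last, with c the last weight. *)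
suff H (c : R) : 0 <= c -> (forall i, c <= w i) ->
    c * \sum_i d i <= \sum_i w i * d i.
  by have := H 0 (lexx 0) w0; rewrite mul0r.
elim: n w d w0 wdec dge0 c => [|n IHn] w d w0 wdec dge0 c c0 cw.
  by rewrite !big_ord0 mulr0.
have dn : 0 <= \sum_i d i.
  have := dge0 n.+1 (leqnn _).
  by rewrite (eq_bigl xpredT) // => i; rewrite ltn_ord.
apply: le_trans (ler_wpM2r dn (cw ord_max)) _.
rewrite !big_ord_recr/= mulrDr lerD2r.
apply: IHn => // [i j ij|k kn|i]; first exact: wdec.
- have := dge0 k (leqW kn); rewrite big_mkcond big_ord_recr /= ltnNge kn addr0.
  by rewrite -big_mkcond.
- by apply: wdec; rewrite /= ltnW.
Qed.

(** The largest value of a linear functional over weights in [0, 1] with total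
    at most [k] is reached on the [k] largest entries.  If [k < n], let [t] be
    the [k+1]-st largest entry: then
    [c i * z i <= t * c i + max 0 (z i - t)], and equality holds in the sum when
    [c] is the indicator of those entries. *)
Lemma sum_le_top (R : realType) n k (c z : 'I_n -> R) :
  (forall i, 0 <= c i <= 1) -> \sum_i c i <= k%:R ->
  (forall i, 0 <= z i) -> (forall i j : 'I_n, (i <= j)%N -> z j <= z i) ->
  \sum_i c i * z i <= \sum_(i < n | (i < k)%N) z i.
Proof.
move=> c01 ck z0 zdec.
case: (ltnP k n) => [kn|nk]; last first.
  rewrite [leRHS](eq_bigl xpredT) => [|i].
    by apply: ler_sum => i _; have /andP[_ c1] := c01 i; rewrite ler_piMl.
  by rewrite (leq_trans (ltn_ord i)).
pose t := z (Ordinal kn).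
have t0 : 0 <= t by exact: z0.
have -> : \sum_(i < n | (i < k)%N) z i =
    t * k%:R + \sum_(i < n | (i < k)%N) (z i - t).
  rewrite sumrB sumr_const addrCA mulr_natr.
  suff -> : #|[pred i : 'I_n | (i < k)%N]| = k by rewrite subrr addr0.
  rewrite -sum1_card -(big_ord_widen _ (fun=> 1%N) (ltnW kn)).
  by rewrite sum1_card card_ord.
apply: le_trans (lerD (ler_wpM2l t0 ck) (lexx _)).
rewrite mulr_sumr [X in _ + X]big_mkcond -big_split /=.
apply: ler_sum => i _; have /andP[c0 c1] := c01 i.
case: ltnP => ik.
  have : t <= z i by apply: zdec; rewrite /= ltnW.
  by rewrite -subr_ge0; nra.
have : z i <= t by apply: zdec.
by rewrite addr0 mulrC; apply: ler_wpM2r.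
Qed.

(** * Monotonicity of p-norms under weak majorization *)

Definition lnorm (R : realType) n (p : R) (x : 'I_n -> R) : R :=
  (n%:R^-1 * \sum_i x i `^ p) `^ p^-1.

(** The tangent line inequality of the convex function [x `^ p], divided by
    [p]. *)
Lemma young_powR (R : realType) (p x z : R) :
  1 <= p -> 0 <= x -> 0 <= z ->
  x `^ (p - 1) * z <= p^-1 * z `^ p + (1 - p^-1) * x `^ p.
Proof.
rewrite le_eqVlt => /predU1P[<- x0 z0|p1 x0 z0].
  by rewrite !subrr powRr0 invr1 subrr mul0r addr0 !mul1r powRr1.
have p0 : 0 < p by rewrite (lt_trans ltr01).
have q0 : 0 < p - 1 by rewrite subr_gt0.
have pq : p^-1 + (p / (p - 1))^-1 = 1 by field; rewrite !gt_eqF.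
have := @conjugate_powR _ z (x `^ (p - 1)) p (p / (p - 1)) z0 (powR_ge0 _ _) p0
  (divr_gt0 p0 q0) pq.
rewrite -powRrM (mulrC (p - 1)) divfK ?gt_eqF// [z * _]mulrC.
suff -> : 1 - p^-1 = (p / (p - 1))^-1 by rewrite ![_^-1 * _]mulrC.
by rewrite -{1}pq addrC addKr.
Qed.

Lemma lnorm_perm (R : realType) n (p : R) (x : 'I_n -> R) (s : 'S_n) :
  lnorm p (x \o s) = lnorm p x.
Proof. by rewrite /lnorm [in RHS](reindex_inj (@perm_inj _ s)). Qed.

Section LNorm.
Variables (R : realType) (n : nat) (p : R).
Hypothesis p1 : 1 <= p.
Let p0 : 0 < p. Proof. exact: lt_le_trans p1. Qed.

Lemma lnorm_ge0 (x : 'I_n -> R) : 0 <= lnorm p x.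
Proof. exact: powR_ge0. Qed.

Lemma lnorm_powR (x : 'I_n -> R) : lnorm p x `^ p = n%:R^-1 * \sum_i x i `^ p.
Proof.
rewrite /lnorm -powRrM mulVf ?gt_eqF// powRr1// mulr_ge0// ?invr_ge0//.
by apply: sumr_ge0 => i _; exact: powR_ge0.
Qed.

(** Hölder's inequality in the form that avoids the conjugate exponent.  After
    [z] is rescaled to the norm of [x], summing the tangent inequalities at
    [x i] makes the [p]-th powers cancel. *)
Lemma lnorm_holder (x z : 'I_n -> R) :
  (forall i, 0 <= x i) -> (forall i, 0 <= z i) ->
  lnorm p x * \sum_i x i `^ (p - 1) * z i <= lnorm p z * \sum_i x i `^ p.
Proof.
move=> x0 z0.
have [S0|SN0] := eqVneq (\sum_i x i `^ p) 0.
  rewrite {1}/lnorm S0 mulr0 powR0 ?invr_eq0 ?gt_eqF// mul0r.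
  exact: mulr_ge0 (lnorm_ge0 z) (lexx 0).
have n0 : (0 < n)%N.
  rewrite lt0n; apply: contra_neq SN0 => n0.
  by apply: big1 => i _; have := ltn_ord i; rewrite {2}n0.
have nR : (n%:R : R) != 0 by rewrite pnatr_eq0 -lt0n.
have [Z0|ZN0] := eqVneq (lnorm p z) 0.
  rewrite big1 ?Z0 ?mulr0 ?mul0r// => i _.
  have := lnorm_powR z; rewrite Z0 powR0 ?gt_eqF// => /esym/eqP.
  rewrite mulf_eq0 invr_eq0 (negbTE nR)/= psumr_eq0 => [|j _];
    last exact: powR_ge0.
  by move=> /allP/(_ i (mem_index_enum _))/eqP/powR_eq0_eq0->; rewrite mulr0.
have Z0 : 0 < lnorm p z by rewrite lt_neqAle eq_sym ZN0 lnorm_ge0.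
pose c := lnorm p x / lnorm p z.
have c0 : 0 <= c by exact: (divr_ge0 (lnorm_ge0 _) (lnorm_ge0 _)).
have czE : \sum_i (c * z i) `^ p = \sum_i x i `^ p.
  under eq_bigr do rewrite powRM//.
  rewrite -mulr_sumr.
  have E (y : 'I_n -> R) : \sum_i y i `^ p = n%:R * lnorm p y `^ p.
    by rewrite lnorm_powR mulrA divff// mul1r.
  by rewrite !E mulrCA -powRM ?lnorm_ge0// /c divfK.
suff H : c * \sum_i x i `^ (p - 1) * z i <= \sum_i x i `^ p.
  move: H; rewrite /c mulrAC ler_pdivrMr// [leRHS]mulrC; exact.
rewrite mulr_sumr.
have -> : \sum_i x i `^ p =
    \sum_i (p^-1 * (c * z i) `^ p + (1 - p^-1) * x i `^ p).
  by rewrite big_split -!mulr_sumr czE /=; ring.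
apply: ler_sum => i _; rewrite mulrCA.
by apply: young_powR => //; rewrite mulr_ge0.
Qed.

(** Testing against the dual vector [x i `^ (p - 1)] of [x], which is
    nonincreasing like [x]: summation by parts turns the hypothesis on the
    initial sums into an inequality between pairings, and Hölder's inequality
    bounds the right-hand pairings. *)
Lemma lnorm_weak_majorization (C D : R) (x a b : 'I_n -> R) :
  0 <= C -> 0 <= D ->
  (forall i, 0 <= x i) -> (forall i, 0 <= a i) -> (forall i, 0 <= b i) ->
  (forall i j : 'I_n, (i <= j)%N -> x j <= x i) ->
  (forall k, \sum_(i < n | (i < k)%N) x i <=
    C * \sum_(i < n | (i < k)%N) a i + D * \sum_(i < n | (i < k)%N) b i) ->
  lnorm p x <= C * lnorm p a + D * lnorm p b.
Proof.
move=> C0 D0 x0 a0 b0 xdec maj.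
have Sx : 0 <= \sum_i x i `^ p by apply: sumr_ge0 => i _; exact: powR_ge0.
have [S0|SN0] := eqVneq (\sum_i x i `^ p) 0.
  rewrite {1}/lnorm S0 mulr0 powR0 ?invr_eq0 ?gt_eqF//.
  by rewrite addr_ge0// mulr_ge0// lnorm_ge0.
have Sgt : 0 < \sum_i x i `^ p by rewrite lt_neqAle eq_sym SN0.
have : 0 <= \sum_i x i `^ (p - 1) * (C * a i + D * b i - x i).
  apply: abel_sum_ge0 => [i|i j ij|k _]; first exact: powR_ge0.
    by apply: ge0_ler_powR; rewrite ?subr_ge0 ?nnegrE ?xdec.
  by rewrite sumrB big_split /= -!mulr_sumr subr_ge0.
have -> : \sum_i x i `^ (p - 1) * (C * a i + D * b i - x i) =
    C * (\sum_i x i `^ (p - 1) * a i) + D * (\sum_i x i `^ (p - 1) * b i) -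
    \sum_i x i `^ p.
  rewrite !mulr_sumr -big_split -sumrB /=; apply: eq_bigr => i _.
  by rewrite -(mulr_powRB1 (x0 i) p0); ring.
have := lnorm_holder x0 a0; have := lnorm_holder x0 b0.
have := lnorm_ge0 x.
move: (lnorm p x) (lnorm p a) (lnorm p b) (\sum_i _ * a i) (\sum_i _ * b i).
move=> X A B Sa Sb X0 HB HA Hab.
rewrite -(ler_pM2r Sgt).
have := ler_wpM2l X0 Hab; have := ler_wpM2l C0 HA; have := ler_wpM2l D0 HB.
by rewrite mulr0; lra.
Qed.

End LNorm.

(** * The spread of a vector with entries 1, 0, -1 *)

(** For [a + b <= n], this is the pairing of [x] with the nonincreasing vector
    that has [a] entries 1, [b] entries -1 and zeros in between. *)
Definition contrast (R : realType) n (a b : nat) (x : 'I_n -> R) : R :=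
  \sum_(i < n) ((i < a)%N%:R - (n - b <= i)%N%:R) * x i.

(** By the covariance identity, [n * contrast a b x] and [n * contrast b a x]
    are the values of the left-hand side when the entries of [e] are arranged in
    nonincreasing and in nondecreasing order, so these two extreme arrangements
    are claimed to dominate all others.  Once the values of [e] are fixed, every
    term is linear in the sorted centered vector [x], and in each of the
    3 ^ n cases the claim is a consequence of linear inequalities. *)
Lemma sorted_spread_le_contrast (R : realType) n (e : 'I_n -> int)
    (x : 'I_n -> R) (K : R) :
  (n <= 4)%N -> (forall i, e i \in [:: 1; 0; -1]) ->
  (forall i j : 'I_n, (i <= j)%N -> x j <= x i) ->
  \sum_i x i = 0 ->
  let a := (\sum_i (e i == 1)%R)%N in let b := (\sum_i (e i == -1)%R)%N in
  contrast a b x <= K -> contrast b a x <= K ->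
  \sum_(i < n) \sum_(j < n) ((i < j) * `|e i - e j|)%N%:R * (x i - x j) <=
  n%:R * K.
Proof.
have simp := (mul0n, mul1n, subnn, addn0, add0n, addn1).
case: n e x => [|[|[|[|[|//]]]]] e x _ eP xs; rewrite /contrast /=.
- by rewrite !big_ord0 mul0r.
- move: (eP ord0); rewrite !big_ord_recl !big_ord0 /=.
  move: (x _) (e _) => x0 e0.
  by rewrite !inE => /or3P[] /eqP->; rewrite /= !simp; lra.
- move: (eP ord0) (eP (lift ord0 ord0)) (xs ord0 (lift ord0 ord0) isT).
  rewrite !big_ord_recl !big_ord0 /= /bump.
  move: (x ord0) (e ord0) (x _) (e _) => x0 e0 x1 e1.
  by rewrite !inE => /or3P[] /eqP-> /or3P[] /eqP->; rewrite /= !simp; lra.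
- set i1 : 'I_3 := lift ord0 ord0.
  set i2 : 'I_3 := lift ord0 (lift ord0 ord0).
  move: (eP ord0) (eP i1) (eP i2) (xs ord0 i1 isT) (xs i1 i2 isT).
  rewrite !big_ord_recl !big_ord0 /= /bump -/i1 -/i2.
  move: (x ord0) (e ord0) (x i1) (e i1) (x i2) (e i2) => x0 e0 x1 e1 x2 e2.
  by rewrite !inE => /or3P[] /eqP-> /or3P[] /eqP-> /or3P[] /eqP->;
    rewrite /= !simp; lra.
- set i1 : 'I_4 := lift ord0 ord0.
  set i2 : 'I_4 := lift ord0 (lift ord0 ord0).
  set i3 : 'I_4 := lift ord0 (lift ord0 (lift ord0 ord0)).
  move: (eP ord0) (eP i1) (eP i2) (eP i3).
  move: (xs ord0 i1 isT) (xs i1 i2 isT) (xs i2 i3 isT).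
  rewrite !big_ord_recl !big_ord0 /= /bump -/i1 -/i2 -/i3.
  move: (x ord0) (x i1) (x i2) (x i3) => x0 x1 x2 x3.
  move: (e ord0) (e i1) (e i2) (e i3) => e0 e1 e2 e3 x10 x21 x32.
  by rewrite !inE => /or3P[] /eqP-> /or3P[] /eqP-> /or3P[] /eqP->
    /or3P[] /eqP->; rewrite /= !simp; lra.
Qed.

Lemma sum_ord_ltn n k : (\sum_(i < n) (i < k) <= k)%N.
Proof.
suff -> : (\sum_(i < n) (i < k))%N = minn n k by rewrite geq_minr.
elim: n => [|n IHn]; first by rewrite big_ord0 min0n.
by rewrite big_ord_recr /= IHn; case: ltnP => ?; lia.
Qed.

(** The covariance identity: pairing with a centered vector depends only on its
    differences. *)
Lemma sum_sum_subM (R : comRingType) n (e h : 'I_n -> R) : \sum_i h i = 0 ->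
  \sum_i \sum_j (e i - e j) * (h i - h j) = 2 * (n%:R * \sum_i e i * h i).
Proof.
move=> h0; pose S := \sum_i e i * h i; pose T := \sum_i e i.
transitivity (\sum_i (n%:R * (e i * h i) - T * h i + S)).
  apply: eq_bigr => i _.
  transitivity (\sum_j (e i * h i - e i * h j - e j * h i + e j * h j)).
    by apply: eq_bigr => j _; ring.
  rewrite big_split !sumrB /= sumr_const card_ord -mulr_sumr h0 mulr0 subr0.
  by rewrite -mulr_suml mulr_natl.
rewrite big_split sumrB /= -!mulr_sumr h0 mulr0 subr0 sumr_const card_ord.
by rewrite -/S -mulr_natl; ring.
Qed.

Section Spread.
Variables (R : realType) (n : nat).
Implicit Types (e : 'I_n -> int) (x : 'I_n -> R).

Definition spread e x : R :=
  \sum_i \sum_j `|e i - e j|%N%:R * `|x i - x j|.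

Lemma spread_perm e x (s : 'S_n) :
  spread (e \o s) (x \o s) = spread e x.
Proof.
rewrite /spread [RHS](reindex_inj (@perm_inj _ s)); apply: eq_bigr => i _ /=.
by rewrite [RHS](reindex_inj (@perm_inj _ s)).
Qed.

Lemma spread_sorted e x :
  (forall i j : 'I_n, (i <= j)%N -> x j <= x i) ->
  spread e x =
  2 * \sum_(i < n) \sum_(j < n) ((i < j) * `|e i - e j|)%N%:R * (x i - x j).
Proof.
move=> xdec; rewrite /spread mulr_natl mulr2n.
rewrite [X in _ = X + _]exchange_big /= -big_split /=; apply: eq_bigr => i _.
rewrite -big_split /=; apply: eq_bigr => j _.
rewrite distnC.
case: (ltngtP i j) => [ij|ji|/val_inj->].
- by rewrite mul0n mul0r add0r mul1n distnC ger0_norm// subr_ge0 xdec// ltnW.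
- by rewrite mul0n mul0r addr0 mul1n distrC ger0_norm// subr_ge0 xdec// ltnW.
- by rewrite !subrr normr0 !mulr0 addr0.
Qed.

Lemma contrast_le_top a b x (s : 'S_n) :
  (forall i j : 'I_n, (i <= j)%N -> `|x (s j)| <= `|x (s i)|) ->
  contrast a b x <= \sum_(i < n | (i < a + b)%N) `|x (s i)|.
Proof.
move=> sdec.
pose c (i : 'I_n) : R := `|(i < a)%N%:R - (n - b <= i)%N%:R|.
apply: (@le_trans _ _ (\sum_i c (s i) * `|x (s i)|)).
  rewrite -(reindex_inj (@perm_inj _ s) (P := xpredT)
    (F := fun i => c i * `|x i|)).
  apply: ler_sum => i _; rewrite -normrM; exact: ler_norm.
apply: sum_le_top => //.
  move=> i; rewrite normr_ge0 /=.
  by rewrite /c; case: (s i < a)%N; case: (n - b <= s i)%N;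
    rewrite /= ?subrr ?subr0 ?sub0r ?normrN ?normr0 ?normr1.
rewrite -(reindex_inj (@perm_inj _ s) (P := xpredT) (F := c)) natrD.
apply: (@le_trans _ _ (\sum_(i < n) ((i < a)%N%:R + (n - b <= i)%N%:R))).
  by apply: ler_sum => i _; rewrite (le_trans (ler_normB _ _))// !ger0_norm.
rewrite big_split /= -!natr_sum lerD// ler_nat.
  exact: sum_ord_ltn.
have geE : (\sum_(i < n) (n - b <= i) = \sum_(i < n) (i < n - (n - b)))%N.
  rewrite (reindex_inj rev_ord_inj); apply: eq_bigr => i _ /=.
  by congr nat_of_bool; have := ltn_ord i; lia.
by rewrite geE (leq_trans (sum_ord_ltn _ _))//; lia.
Qed.

(** Up to the factor [2 * n], the spread is at most a Ky Fan norm: after sorting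
    by the permutation [t], it is dominated by a contrast with as many nonzero
    entries as [e].  Two sorting permutations are involved, since [x] is sorted
    by value by [t] and by absolute value by [s]. *)
Lemma spread_le_top e x (s : 'S_n) k :
  (n <= 4)%N -> (forall i, e i \in [:: 1; 0; -1]) ->
  (\sum_i `|e i| <= k)%N -> \sum_i x i = 0 ->
  (forall i j : 'I_n, (i <= j)%N -> `|x (s j)| <= `|x (s i)|) ->
  spread e x <= 2 * (n%:R * \sum_(i < n | (i < k)%N) `|x (s i)|).
Proof.
move=> n4 eP ek x0 sdec.
have [t tdec] := exists_sorting_perm x.
rewrite -(spread_perm e x t) spread_sorted// ler_wpM2l//.
have abk : (\sum_i (e (t i) == 1)%R + \sum_i (e (t i) == -1)%R <= k)%N.
  apply: leq_trans ek; rewrite [leqRHS](reindex_inj (@perm_inj _ t)) /=.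
  rewrite -big_split /=; apply: leq_sum => i _.
  by move: (eP (t i)); rewrite !inE => /or3P[] /eqP->.
have contrast_le a b : (a + b <= k)%N -> contrast a b (x \o t) <=
    \sum_(i < n | (i < k)%N) `|x (s i)|.
  move=> abk'; apply: le_trans (@contrast_le_top a b (x \o t) (s * t^-1)%g _) _.
    by move=> i j ij /=; rewrite !permM !permKV sdec.
  rewrite big_mkcond [leRHS]big_mkcond; apply: ler_sum => i _ /=.
  rewrite permM permKV; case: ifPn => [iab|_]; last by case: ifP.
  by rewrite (leq_trans iab abk').
apply: sorted_spread_le_contrast => //.
- by move=> i /=; exact: eP.
- by rewrite -[RHS]x0 [RHS](reindex_inj (@perm_inj _ t)).
- exact: contrast_le.
- by apply: contrast_le; rewrite addnC.
Qed.

End Spread.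

(** The implication of [sigma_le] for Ky Fan norms. *)
Lemma kyfan_le (R : realType) n (C D : R) (h u v : 'I_n -> R)
    (sh su sv : 'S_n) (k : nat) :
  (n <= 4)%N -> 0 <= C -> 0 <= D ->
  \sum_i h i = 0 -> \sum_i u i = 0 -> \sum_i v i = 0 ->
  (forall i j : 'I_n, (i <= j)%N -> `|u (su j)| <= `|u (su i)|) ->
  (forall i j : 'I_n, (i <= j)%N -> `|v (sv j)| <= `|v (sv i)|) ->
  (forall i j, `|h i - h j| <= C * `|u i - u j| + D * `|v i - v j|) ->
  \sum_(i < n | (i < k)%N) `|h (sh i)| <=
  C * (\sum_(i < n | (i < k)%N) `|u (su i)|) +
  D * (\sum_(i < n | (i < k)%N) `|v (sv i)|).
Proof.
move=> n4 C0 D0 h0 u0 v0 udec vdec huv.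
have [n0|n0] := posnP n.
  by rewrite !big1 ?mulr0 ?addr0// => i; have := ltn_ord i; rewrite {2}n0.
(* With this e, the left-hand side is the pairing of e with h. *)
pose e i : int := if ((sh^-1)%g i < k)%N then sgz (h i) else 0.
have eP i : e i \in [:: 1; 0; -1].
  by rewrite /e; case: ifP => // _; rewrite !inE; case: sgzP.
have ek : (\sum_i `|e i| <= k)%N.
  rewrite (reindex_inj (@perm_inj _ sh)) /=.
  apply: (@leq_trans (\sum_(i < n) (i < k))%N).
    apply: leq_sum => i _; rewrite /e permK; case: ifP => // _.
    by case: sgzP.
  exact: sum_ord_ltn.
have hE : \sum_(i < n | (i < k)%N) `|h (sh i)| = \sum_i (e i)%:~R * h i.
  rewrite [RHS](reindex_inj (@perm_inj _ sh)) big_mkcond /=.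
  apply: eq_bigr => i _; rewrite /e permK; case: ifP => _;
    last by rewrite mul0r.
  by rewrite normrEsg sgrEz.
have covE : 2 * (n%:R * \sum_i (e i)%:~R * h i) =
    \sum_i \sum_j ((e i)%:~R - (e j)%:~R) * (h i - h j).
  exact/esym/sum_sum_subM.
have spr : 2 * (n%:R * \sum_i (e i)%:~R * h i) <=
    C * spread e u + D * spread e v.
  rewrite covE !mulr_sumr -big_split /=; apply: ler_sum => i _.
  rewrite !mulr_sumr -big_split /=; apply: ler_sum => j _.
  apply: le_trans (ler_norm _) _; rewrite normrM -rmorphB -intr_norm -abszE.
  by rewrite mulrCA [D * _]mulrCA -mulrDr ler_wpM2l.
rewrite hE -(@ler_pM2l _ (2 * n%:R)) ?mulr_gt0 ?ltr0n//.
rewrite -mulrA (le_trans spr)// mulrDr lerD// mulrCA ler_wpM2l// -mulrA.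
  exact: spread_le_top.
exact: spread_le_top.
Qed.

(** * Centered moments *)

Lemma sum_centered (R : realType) n (f : linf R n) : \sum_i (f i - mean f) = 0.
Proof.
case: n f => [|n] f; first by rewrite big_ord0.
rewrite sumrB sumr_const card_ord /mean -[X in _ - X]mulr_natl.
by rewrite mulrA divff ?mul1r ?subrr// pnatr_eq0.
Qed.

(** Domination of differences passes to [sigma p]: sort the three vectors of
    absolute deviations, which changes no norm, and combine the Ky Fan
    inequalities with monotonicity under weak majorization. *)
Lemma sigma_le (R : realType) n (p C D : R) (h u v : linf R n) :
  (n <= 4)%N -> 1 <= p -> 0 <= C -> 0 <= D ->
  (forall i j, `|h i - h j| <= C * `|u i - u j| + D * `|v i - v j|) ->
  sigma p h <= C * sigma p u + D * sigma p v.
Proof.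
move=> n4 p1 C0 D0 huv.
pose dev (f : linf R n) i : R := `|f i - mean f|.
have sigmaE f : sigma p f = lnorm p (dev f) by [].
have [sh hdec] := exists_sorting_perm (dev h).
have [su udec] := exists_sorting_perm (dev u).
have [sv vdec] := exists_sorting_perm (dev v).
rewrite !sigmaE -(lnorm_perm p (dev h) sh) -(lnorm_perm p (dev u) su)
  -(lnorm_perm p (dev v) sv).
apply: lnorm_weak_majorization => // [i|i|i|k] /=; try exact: normr_ge0.
apply: (kyfan_le (h := fun i => h i - mean h) (u := fun i => u i - mean u)
  (v := fun i => v i - mean v)) => //; try exact: sum_centered.
have subB (f : linf R n) i j :
    f i - mean f - (f j - mean f) = f i - f j by ring.
by move=> i j; rewrite !subB.
Qed.

Theorem corollary2p10 (R : realType) (n : nat) (p : R) :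
  (1 <= n.+1 <= 4)%N -> 1 <= p -> strongly_leibniz (@sigma R n.+1 p).
Proof.
move=> /andP[_ n4] p1.
have norm_ge0 (f : linf R n.+1) : 0 <= algnorm f by exact: linf_norm_ge0.
have norm_ge (f : linf R n.+1) i : `|f i| <= algnorm f by exact: linf_norm_ge.
have le1 (C : R) (h u : linf R n.+1) :
    0 <= C -> (forall i j, `|h i - h j| <= C * `|u i - u j|) ->
    sigma p h <= C * sigma p u.
  move=> C0 hu; rewrite -[leRHS]addr0 -[X in _ + X](mul0r (sigma p u)).
  by apply: sigma_le => // i j; rewrite mul0r addr0.
have sigmaZ_le (k : R) (f : linf R n.+1) : sigma p (k *: f) <= `|k| * sigma p f.
  by apply: le1 => // i j; rewrite !linf_scaleE -mulrBr normrM.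
split; first split.
- by move=> f; exact: powR_ge0.
- move=> k f; apply/le_anti/andP; split; first exact: sigmaZ_le.
  have [->|k0] := eqVneq k 0; first by rewrite normr0 mul0r powR_ge0.
  rewrite -ler_pdivlMl ?normr_gt0// -normfV.
  apply: le1 => // i j; rewrite !linf_scaleE -mulrBr -normrM.
  by rewrite mulrA mulVf// mul1r.
- move=> f g; rewrite -[sigma p f]mul1r -[sigma p g]mul1r.
  apply: sigma_le => // i j; rewrite !mul1r !linf_addE.
  by rewrite opprD addrACA ler_normD.
- apply/le_anti; rewrite powR_ge0 andbT.
  rewrite -[leRHS](mul0r (sigma p (1 : linf R n.+1))).
  by apply: le1 => // i j; rewrite !ffunE subrr normr0 mul0r.
- move=> f g; apply: sigma_le => // i j; rewrite !linf_mulE.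
  have -> : f i * g i - f j * g j =
      f i * (g i - g j) + g j * (f i - f j) by ring.
  by rewrite (le_trans (ler_normD _ _))// !normrM lerD// ler_wpM2r.
- move=> f uf; apply: le1; first exact: exprn_ge0.
  move=> i j.
  have f0 k : f k != 0 by apply/forallP: k; exact: uf.
  have fV k : (f^-1) k = (f k)^-1.
    by apply: (mulfI (f0 k)); rewrite -linf_mulE divrr// ffunE divff.
  rewrite distrC !fV.
  have -> : (f j)^-1 - (f i)^-1 = (f i)^-1 * (f j)^-1 * (f i - f j).
    by field; rewrite !f0.
  by rewrite normrM normrM ler_wpM2r// expr2 ler_pM// -fV.
Qed.
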